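(* Define the operator $T$ on $L^2(\mathbb{R})\cap L^\infty(\mathbb{R})$ by $(Tf)(x)=f(2x)$ for $x\in\mathbb{R}$. Its adjoint with respect to the $L^2(\mathbb{R})$ inner product acts on $L^2(\mathbb{R})\cap L^\infty(\mathbb{R})$ by $(T^*f)(x)=\frac12 f\left(\frac x2\right)$. Then $T$ is a contraction with respect to both $\|\cdot\|_2$ and $\|\cdot\|_\infty$, and $\Gamma_2(T)$ and $\Gamma_2(T^* )$ are contractions on the quadratic Fock space $\Gamma_2(L^2(\mathbb{R})\cap L^\infty(\mathbb{R}))$, but $$\Gamma_2(T^* )\neq(\Gamma_2(T))^*.$$
   Context: All function spaces consist of complex-valued functions modulo a.e. equality for Lebesgue measure on $\mathbb{R}$, and $\langle f,g\rangle=\int_{\mathbb{R}}\overline{f(s)}g(s)\,ds$. Fix a constant $c>0$. Quadratic Fock space. $\Gamma_2(L^2(\mathbb{R})\cap L^\infty(\mathbb{R}))$ is the Hilbert space which is the closed linear span of vectors $B^{+n}_f\Phi$, $n\in\mathbb{N}$, $f\in L^2(\mathbb{R})\cap L^\infty(\mathbb{R})$, where $B_f^{+0}\Phi=\Phi$ is a unit vector, vectors with different $n$ are orthogonal, and for $n\ge1$ $$\langle B^{+n}_f\Phi,B^{+n}_g\Phi\rangle=c\sum_{k=0}^{n-1}2^{2k+1}\frac{n!(n-1)!}{((n-k-1)!)^2}\langle f^{k+1},g^{k+1}\rangle\langle B^{+(n-k-1)}_f\Phi,B^{+(n-k-1)}_g\Phi\rangle .$$ Quadratic exponential vectors. For $f\in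 L^2(\mathbb{R})\cap L^\infty(\mathbb{R})$ with $\|f\|_\infty<\frac12$, the vector $\Psi(f)=\sum_{n\ge0}\frac{1}{n!}B_f^{+n}\Phi$ exists (with $\Psi(0)=\Phi$), and $$\langle\Psi(f),\Psi(g)\rangle=\exp\Big(-\frac c2\int_{\mathbb{R}}\ln\big(1-4\overline{f(s)}g(s)\big)\,ds\Big).$$ These vectors are linearly independent and total, so this formula determines the space up to unitary equivalence. Quadratic quantization. For a linear operator $S$ on $L^2(\mathbb{R})\cap L^\infty(\mathbb{R})$ that is a contraction for $\|\cdot\|_\infty$, $\Gamma_2(S)$ is the linear operator determined by $\Gamma_2(S)\Psi(f)=\Psi(Sf)$ for all $f$ with $\|f\|_\infty<\frac12$, defined on the (dense) linear span of these exponential vectors and, when it is bounded there, extended by continuity to the whole quadratic Fock space. ''$\Gamma_2(S)$ is a contraction'' means $\|\Gamma_2(S)\xi\|\le\|\xi\|$ for all $\xi$. *)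

(* Defs.v *)
(* MathComp / MathComp-Analysis *)
From HB Require Import structures.
From mathcomp Require Import all_boot all_order all_algebra.
From mathcomp Require Import complex.
From mathcomp Require Import all_classical all_reals all_analysis.

Set Implicit Arguments.
Unset Strict Implicit.
Unset Printing Implicit Defensive.

Import Order.TTheory GRing.Theory Num.Theory.
Import numFieldNormedType.Exports.

Local Open Scope classical_set_scope.
Local Open Scope ring_scope.
Local Open Scope complex_scope.

Section FunctionSpaces.
Context {R : realType}.
Implicit Types (f g : R -> R[i]) (S : (R -> R[i]) -> (R -> R[i])).

Definition Cintegral f : R[i] :=
  Rintegral (@lebesgue_measure R) setT (fun s => complex.Re (f s))
  +i* Rintegral (@lebesgue_measure R) setT (fun s => complex.Im (f s)).

(* Conjugate-linear in the first argument. *)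
Definition L2inner f g : R[i] := Cintegral (fun s => Num.conj (f s) * g s).

Definition Cmeasurable f : Prop :=
  measurable_fun [set: measurableTypeR R] (fun s => complex.Re (f s)) /\
  measurable_fun [set: measurableTypeR R] (fun s => complex.Im (f s)).

(* For p = 2 the L^2 norm, for p = +oo the essential supremum norm. *)
Definition Cnorm (p : \bar R) f : \bar R :=
  Lnorm (@lebesgue_measure R) p (fun s => (Normc.normc (f s))%:E).

Definition eqae f g : Prop := ae_eq (@lebesgue_measure R) setT f g.

(* Elements of L^2 and L^oo are represented by functions; everything below is
   required, or follows, to be invariant under [eqae]. *)
Definition L2Linf f : Prop :=
  [/\ Cmeasurable f, (Cnorm 2%:E f < +oo)%E & (Cnorm +oo%E f < +oo)%E].

(* A linear operator on L^2 \cap L^oo modulo a.e. equality. *)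
Definition L2Linf_operator S : Prop :=
  [/\ forall f, L2Linf f -> L2Linf (S f),
      forall f g, L2Linf f -> L2Linf g -> eqae f g -> eqae (S f) (S g) &
      forall (a : R[i]) f g, L2Linf f -> L2Linf g ->
        eqae (S (fun s => a * f s + g s)) (fun s => a * S f s + S g s)].

Definition norm_contraction (p : \bar R) S : Prop :=
  forall f, L2Linf f -> (Cnorm p (S f) <= Cnorm p f)%E.

Definition dilation f : R -> R[i] := fun x => f (2 * x).

Definition dilation_adj f : R -> R[i] := fun x => 2^-1 * f (x / 2).

End FunctionSpaces.

Section QuadraticFock.
Context {R : realType} {H : completeNormedModType R[i]}.
Implicit Types (form : {dot H for Num.conj}) (B : nat -> (R -> R[i]) -> H).

(* The library's sesquilinear forms are conjugate-linear in the second
   argument, hence the swap. *)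
Definition braket form (x y : H) : R[i] := form y x.

Definition norm_from form : Prop := forall x : H, `|x| ^+ 2 = braket form x x.

Definition linear_span (A : set H) : set H :=
  [set v | exists (n : nat) (a : 'I_n -> R[i]) (u : 'I_n -> H),
     (forall i, A (u i)) /\ v = \sum_(i < n) a i *: u i].

(* [B n f] is the vector B_f^{+n} Phi.  These conditions determine the Hilbert
   space [H] with its vectors [B n f] up to unitary equivalence. *)
Record quadratic_Fock (c : R) form (Phi : H) B : Prop := QuadraticFock {
  fock_norm : norm_from form ;
  fock_vacuum : `|Phi| = 1 ;
  fock_B0 : forall f, L2Linf f -> B 0%N f = Phi ;
  fock_ae : forall n f g, L2Linf f -> L2Linf g -> eqae f g -> B n f = B n g ;
  fock_orth : forall m n f g, L2Linf f -> L2Linf g -> m <> n ->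
    braket form (B m f) (B n g) = 0 ;
  fock_inner : forall n f g, (0 < n)%N -> L2Linf f -> L2Linf g ->
    braket form (B n f) (B n g) =
    c%:C * \sum_(k < n)
      2 ^+ (2 * k + 1)
      * ((n`! * (n - 1)`!)%:R / ((n - k - 1)`! ^ 2)%:R)
      * L2inner (fun s => f s ^+ (k + 1)) (fun s => g s ^+ (k + 1))
      * braket form (B (n - k - 1)%N f) (B (n - k - 1)%N g) ;
  fock_total :
    closure (linear_span [set v | exists n f, L2Linf f /\ v = B n f]) = setT
}.

Definition Psi B (f : R -> R[i]) : H :=
  lim (series (fun n => (n`!%:R)^-1 *: B n f) @ \oo).

(* [G] is the bounded operator Gamma_2(S): the continuous linear extension to
   the whole of [H] of Psi(f) |-> Psi(S f), ||f||_oo < 1/2. *)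
Definition quadratic_quantization B (S : (R -> R[i]) -> (R -> R[i]))
    (G : {linear H -> H}) : Prop :=
  [/\ L2Linf_operator S, norm_contraction +oo%E S, continuous G &
      forall f, L2Linf f -> (Cnorm +oo%E f < (2^-1)%:E)%E ->
        G (Psi B f) = Psi B (S f)].

Definition contraction_op (G : H -> H) : Prop := forall xi, `|G xi| <= `|xi|.

(* [A] is the Hilbert space adjoint of [G]. *)
Definition is_adjoint form (G A : H -> H) : Prop :=
  forall x y, braket form (A x) y = braket form x (G y).

End QuadraticFock.

(* Main.v *)
(* With K_n(f, g) = <B_f^{+n} Phi, B_g^{+n} Phi> and s_k(f, g) = <f^k, g^k>, the
   defining recursion reads K_n = c sum_k w_{n,k} s_{k+1} K_{n-k-1}, w >= 0.
   Both T and its adjoint T' have the form (S f)(x) = b f(a x) with b <= 1 and b^2 <= a,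
   and then s_k(S f, S g) = th_k s_k(f, g) with th_k = b^{2k} / a in [0, 1].
   Hence, by induction on n, K_n - K_n o S is a sum of terms
   w s_{k+1} ((1 - th) K + th (K - K o S)), which is a positive definite kernel
   by Schur's theorem.  So B_f^{+n} Phi |-> B_{S f}^{+n} Phi extends to a
   contraction.  Conversely a bounded G with G Psi(t f) = Psi(t S f) for all
   small t must act like this on every B_f^{+n} Phi, by comparing the
   coefficients of two power series in t.  Finally T' is multiplicative only up
   to a factor, (T' f)^2 = T'(f^2) / 2, so the terms s_2 of
   <Gamma_2(T') B_e^{+2} Phi, B_e^{+2} Phi> and <B_e^{+2} Phi, Gamma_2(T) B_e^{+2} Phi>
   differ by a factor 2 while the terms in s_1 agree. *)
Require Import Defs.
From HB Require Import structures.
From mathcomp Require Import all_boot all_order all_algebra.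
From mathcomp Require Import complex.
From mathcomp Require Import all_classical all_reals all_analysis.
From mathcomp Require Import measurable_realfun ess_sup_inf ring lra.

Set Implicit Arguments.
Unset Strict Implicit.
Unset Printing Implicit Defensive.

Import Order.TTheory GRing.Theory Num.Theory.
Import numFieldNormedType.Exports.

Local Open Scope classical_set_scope.
Local Open Scope ring_scope.
Local Open Scope complex_scope.

(** * Change of variables x -> a x in Lebesgue and complex integrals *)

Section Scaling.
Context {R : realType}.
Local Notation mu := (@lebesgue_measure R).
Local Notation TR := (measurableTypeR R).
Implicit Types (a : {posnum R}) (h : R -> R[i]).

Lemma measurable_scale (r : R) : measurable_fun [set: TR] ( *%R r : TR -> TR).
Proof. exact: mulrl_measurable. Qed.

(** By uniqueness of Lebesgue measure: a times the pushforward under x -> a x gives every half-open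
    interval its length. *)
Lemma lebesgue_measure_scale a (A : set TR) : measurable A ->
  mu (( *%R a%:num) @^-1` A) = (((a%:num)^-1)%:E * mu A)%E.
Proof.
move=> mA; have a0 : 0 <= a%:num by [].
pose f : TR -> TR := *%R a%:num.
have mf : measurable_fun setT f by exact: measurable_scale.
have [p pE] : exists p : {measure set TR -> \bar R},
    forall B, p B = mu (f @^-1` B).
  by unshelve eexists (pushforward mu f).
pose m := mscale (NngNum a0) p.
have -> : mu A = m A.
  apply: lebesgue_measure_unique => // _ [[u v]] _ <- /=.
  rewrite /m /mscale/= pE.
  have -> : ( *%R a%:num) @^-1` `]u, v]%classic =
      `](u / a%:num), (v / a%:num)]%classic.
    apply/seteqP; split => x /=; rewrite !in_itv/= => /andP[H1 H2].
      by rewrite ltr_pdivrMr// ler_pdivlMr// ![x * _]mulrC H1.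
    by move: H1 H2; rewrite ltr_pdivrMr// ler_pdivlMr// ![x * _]mulrC => -> ->.
  rewrite !lebesgue_measure_itv/= !lte_fin ltr_pM2r ?invr_gt0//.
  case: ifPn => _; last by rewrite mule0.
  by rewrite -!EFinD -EFinM; congr (_%:E); field.
by rewrite /m /mscale /= pE muleA -EFinM mulVf// mul1e.
Qed.

Lemma ge0_integral_scale a (h : TR -> \bar R) : measurable_fun setT h ->
  (forall x, 0 <= h x)%E ->
  (\int[mu]_x h (a%:num * x)%R = ((a%:num)^-1)%:E * \int[mu]_x h x)%E.
Proof.
move=> mh h0.
have -> : (\int[mu]_x h (a%:num * x)%R =
    \int[pushforward mu ( *%R a%:num : TR -> TR)]_x h x)%E.
  by rewrite ge0_integral_pushforward//; exact: measurable_scale.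
have a0 : 0 <= (a%:num)^-1 by [].
rewrite -(ge0_integral_mscale mu measurableT (NngNum a0))//.
by apply: eq_measure_integral => A mA _; exact: lebesgue_measure_scale.
Qed.

Lemma measurable_fun_scale d (T : measurableType d) a (h : TR -> T) :
  measurable_fun setT h ->
  measurable_fun [set: TR] (fun x : TR => h (a%:num * x)).
Proof. by move=> mh; exact: (measurableT_comp mh (measurable_scale _)). Qed.

Lemma integrable_scale a (h : TR -> \bar R) :
  mu.-integrable setT h -> mu.-integrable setT (fun x => h (a%:num * x)).
Proof.
move=> /integrableP[mh ih]; apply/integrableP; split.
  exact: measurable_fun_scale.
rewrite (@ge0_integral_scale a (fun x => `|h x|%E))//; last exact: measurableT_comp.
by rewrite lte_mul_pinfty.
Qed.

Lemma integral_scale a (h : TR -> \bar R) : mu.-integrable setT h ->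
  (\int[mu]_x h (a%:num * x)%R = ((a%:num)^-1)%:E * \int[mu]_x h x)%E.
Proof.
move=> ih; have mh := measurable_int _ ih.
have -> : (\int[mu]_x h x = \int[mu]_x h^\+ x - \int[mu]_x h^\- x)%E.
  exact: integralE.
rewrite integralE.
under eq_integral do rewrite (funepos_comp h)/=.
rewrite (@ge0_integral_scale a (h^\+)%E)//; last exact/measurable_funepos.
under eq_integral do rewrite (funeneg_comp h)/=.
rewrite (@ge0_integral_scale a (h^\-)%E)//; last exact/measurable_funeneg.
(* Distributing the factor requires a well-defined difference; the negative part has a finite
   integral. *)
rewrite [RHS]muleBr// fin_num_adde_defl//.
by rewrite fin_numN; exact: (integrable_neg_fin_num measurableT ih).
Qed.

Lemma ae_scale a (P : R -> Prop) :
  (\forall x \ae mu, P x) -> \forall x \ae mu, P (a%:num * x).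
Proof.
move=> [N [mN N0 PN]]; exists (( *%R a%:num) @^-1` N); split.
- by rewrite -[X in measurable X]setTI; exact: measurable_scale.
- by rewrite lebesgue_measure_scale// N0 mule0.
- by move=> x /= Px; exact: PN.
Qed.

Definition Cintegrable h : Prop :=
  mu.-integrable setT (fun x => (complex.Re (h x))%:E) /\
  mu.-integrable setT (fun x => (complex.Im (h x))%:E).

Lemma CintegrableD h1 h2 : Cintegrable h1 -> Cintegrable h2 ->
  Cintegrable (fun x => h1 x + h2 x).
Proof.
move=> [i1 j1] [i2 j2]; split.
  apply: eq_integrable (integrableD _ i1 i2) => // x _ /=.
  by case: (h1 x) (h2 x) => ? ? [].
apply: eq_integrable (integrableD _ j1 j2) => // x _ /=.
by case: (h1 x) (h2 x) => ? ? [].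
Qed.

Lemma CintegralD h1 h2 : Cintegrable h1 -> Cintegrable h2 ->
  Cintegral (fun x => h1 x + h2 x) = Cintegral h1 + Cintegral h2.
Proof.
move=> [i1 j1] [i2 j2]; rewrite /Cintegral.
apply/eqP; rewrite eq_complex /=; apply/andP; split; apply/eqP.
  rewrite -RintegralD//; apply: eq_Rintegral => x _.
  by case: (h1 x) (h2 x) => ? ? [].
rewrite -RintegralD//; apply: eq_Rintegral => x _.
by case: (h1 x) (h2 x) => ? ? [].
Qed.

Lemma CintegrableZ (z : R[i]) h : Cintegrable h -> Cintegrable (fun x => z * h x).
Proof.
case: z => a b [i1 j1]; split.
  have ij := integrableB _ (integrableZl _ a i1) (integrableZl _ b j1).
  apply: eq_integrable (ij _ _ _) => // x _ /=.
  by case: (h x).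
have ij := integrableD _ (integrableZl _ a j1) (integrableZl _ b i1).
apply: eq_integrable (ij _ _ _) => // x _ /=.
by case: (h x).
Qed.

Lemma CintegralZ (z : R[i]) h : Cintegrable h ->
  Cintegral (fun x => z * h x) = z * Cintegral h.
Proof.
case: z => a b [i1 j1]; rewrite /Cintegral.
have e (r : R) k : mu.-integrable setT (fun x => (k x)%:E) ->
    mu.-integrable setT (fun x => (r * k x)%:E).
  by move=> ik; apply: eq_integrable (integrableZl _ r ik).
apply/eqP; rewrite eq_complex /=; apply/andP; split; apply/eqP.
  rewrite -!RintegralZl// -RintegralB//; try exact: e.
  by apply: eq_Rintegral => x _; case: (h x).
rewrite -!RintegralZl// -RintegralD//; try exact: e.
by apply: eq_Rintegral => x _; case: (h x).
Qed.

Lemma Cintegrable0 : Cintegrable (fun=> 0).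
Proof. by split; exact: integrable0. Qed.

Lemma Cintegral0 : Cintegral (fun=> 0 : R[i]) = 0.
Proof. by rewrite /Cintegral /= Rintegral_cst// mul0r. Qed.

Lemma Cintegrable_sum (I : Type) (s : seq I) (F : I -> R -> R[i]) :
  (forall i, Cintegrable (F i)) -> Cintegrable (fun x => \sum_(i <- s) F i x).
Proof.
move=> iF; elim: s => [|i s IH].
  by under eq_fun do rewrite big_nil; exact: Cintegrable0.
by under eq_fun do rewrite big_cons; exact: CintegrableD.
Qed.

Lemma Cintegral_sum (I : Type) (s : seq I) (F : I -> R -> R[i]) :
  (forall i, Cintegrable (F i)) ->
  Cintegral (fun x => \sum_(i <- s) F i x) = \sum_(i <- s) Cintegral (F i).
Proof.
move=> iF; elim: s => [|i s IH].
  by under eq_fun do rewrite big_nil; rewrite big_nil Cintegral0.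
under eq_fun do rewrite big_cons; rewrite big_cons CintegralD// ?IH//.
exact: Cintegrable_sum.
Qed.

Lemma Cintegral_ge0 h : (forall x, 0 <= h x) -> 0 <= Cintegral h.
Proof.
move=> h0; rewrite /Cintegral lecE /=; apply/andP; split.
  (* Nonnegativity in R[i] forces the imaginary part to vanish pointwise. *)
  rewrite (_ : (fun _ => _) = cst 0) ?Rintegral_cst ?mul0r//.
  by apply/funext => x; exact: ger0_Im.
by apply: Rintegral_ge0 => x _; have := h0 x; rewrite lecE => /andP[].
Qed.

Lemma Cintegrable_scale a h :
  Cintegrable h -> Cintegrable (fun x => h (a%:num * x)).
Proof.
by move=> [i j]; split;
  [exact: (@integrable_scale a _ i)|exact: (@integrable_scale a _ j)].
Qed.

Lemma Cintegral_scale a h : Cintegrable h ->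
  Cintegral (fun x => h (a%:num * x)) = ((a%:num)^-1)%:C * Cintegral h.
Proof.
move=> [i1 i2]; rewrite /Cintegral /Rintegral.
rewrite (@integral_scale a _ i1) (@integral_scale a _ i2).
rewrite !fineM ?integrable_fin_num//.
by apply/eqP; rewrite eq_complex /= !mul0r subr0 addr0 !eqxx.
Qed.

End Scaling.

(** * Norms, products and powers in L^2 and L^oo *)

Section FunctionSpace.
Context {R : realType}.
Local Notation mu := (@lebesgue_measure R).
Local Notation TR := (measurableTypeR R).
Local Notation normc := Normc.normc.
Implicit Types (f g : R -> R[i]) (a b : {posnum R}).

Let aeF : Filter (almost_everywhere mu) := ae_filter_ringOfSetsType mu.

Lemma aeW (P : R -> Prop) : (forall x, P x) -> \forall x \ae mu, P x.
Proof. exact: (@nearW _ (almost_everywhere mu) P aeF). Qed.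

Lemma aeS (P Q : R -> Prop) : (forall x, P x -> Q x) ->
  (\forall x \ae mu, P x) -> \forall x \ae mu, Q x.
Proof. exact: (@filterS _ _ aeF). Qed.

Lemma aeS2 (P Q S : R -> Prop) : (forall x, P x -> Q x -> S x) ->
  (\forall x \ae mu, P x) -> (\forall x \ae mu, Q x) -> \forall x \ae mu, S x.
Proof. exact: (@filterS2 _ _ aeF). Qed.

Lemma normc_ge0 (z : R[i]) : 0 <= normc z.
Proof. by case: z => x y; exact: sqrtr_ge0. Qed.

Lemma normc_expn (z : R[i]) n : normc (z ^+ n) = normc z ^+ n.
Proof.
by elim: n => [|n IH]; rewrite ?expr0 ?Normc.normc1// !exprS Normc.normcM IH.
Qed.

Lemma sqr_normc_ReIm (z : R[i]) :
  normc z ^+ 2 = complex.Re z ^+ 2 + complex.Im z ^+ 2.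
Proof. by case: z => x y; rewrite /= sqr_sqrtr// addr_ge0// sqr_ge0. Qed.

Lemma normc_real (r : R) : 0 <= r -> normc r%:C = r.
Proof. by move=> r0; rewrite /= expr0n addr0 sqrtr_sqr ger0_norm. Qed.

Lemma Cmeasurable_mul f g : Cmeasurable f -> Cmeasurable g ->
  Cmeasurable (fun x => f x * g x).
Proof.
move=> [mf nf] [mg ng]; split.
  rewrite (_ : (fun s => _) = (fun s => complex.Re (f s) * complex.Re (g s)
      - complex.Im (f s) * complex.Im (g s))).
    by apply: measurable_funB; exact: measurable_funM.
  by apply/funext => s; case: (f s) (g s) => ? ? [].
rewrite (_ : (fun s => _) = (fun s => complex.Re (f s) * complex.Im (g s)
    + complex.Im (f s) * complex.Re (g s))).
  by apply: measurable_funD; exact: measurable_funM.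
by apply/funext => s; case: (f s) (g s) => ? ? [].
Qed.

Lemma Cmeasurable_cst (z : R[i]) : Cmeasurable (fun=> z).
Proof. by split; exact: measurable_cst. Qed.

Lemma Cmeasurable_conj f : Cmeasurable f -> Cmeasurable (fun x => Num.conj (f x)).
Proof.
move=> [mf nf]; split.
  rewrite (_ : (fun s => _) = (fun s => complex.Re (f s)))//.
  by apply/funext => s /=; case: (f s).
rewrite (_ : (fun s => _) = (fun s => - complex.Im (f s)))//.
  exact: measurable_funN.
by apply/funext => s /=; case: (f s).
Qed.

Lemma Cmeasurable_exp f n : Cmeasurable f -> Cmeasurable (fun x => f x ^+ n).
Proof.
move=> mf; elim: n => [|n IH]; first exact: Cmeasurable_cst.
under eq_fun do rewrite exprS.
exact: Cmeasurable_mul.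
Qed.

Lemma measurable_normc f : Cmeasurable f ->
  measurable_fun [set: TR] (fun x => normc (f x)).
Proof.
move=> [mf nf].
rewrite (_ : (fun s => _) =
    Num.sqrt \o (fun s => complex.Re (f s) ^+ 2 + complex.Im (f s) ^+ 2)).
  apply: measurableT_comp.
    by apply: continuous_measurable_fun; exact: sqrt_continuous.
  by apply: measurable_funD; exact: measurable_funX.
by apply/funext => s /=; case: (f s).
Qed.

Lemma measurable_sqr_normc f : Cmeasurable f ->
  measurable_fun [set: TR] (fun x => (normc (f x) ^+ 2)%:E).
Proof.
by move=> mf; apply/measurable_EFinP/measurable_funX; exact: measurable_normc.
Qed.

Lemma Cnorm2E f : Cnorm 2%:E f = ((\int[mu]_x (normc (f x) ^+ 2)%:E) `^ 2^-1)%E.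
Proof.
rewrite /Cnorm unlock; congr (_ `^ _)%E; apply: eq_integral => x _ /=.
by rewrite ger0_norm ?normc_ge0// powR_mulrn// normc_ge0.
Qed.

Lemma Cnorm2_lty f : (Cnorm 2%:E f < +oo)%E <->
  (\int[mu]_x (normc (f x) ^+ 2)%:E < +oo)%E.
Proof.
rewrite Cnorm2E; split; last exact: poweR_lty.
by apply: lty_poweRy; rewrite invr_eq0.
Qed.

Lemma CnormyE f : Cnorm +oo%E f = ess_sup mu (fun x => (normc (f x))%:E).
Proof.
(* The norm at exponent +oo is the essential supremum provided that the whole line has positive
   measure, which []0, 1]] witnesses. *)
rewrite /Cnorm unlock ifT; last first.
  apply: (@lt_le_trans _ _ (mu `]0, 1]%classic)); last first.
    by apply: le_measure; rewrite ?inE.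
  by rewrite lebesgue_measure_itv/= lte_fin ltr01 oppr0 addr0 lte_fin.
congr ess_sup; apply/funext => x /=.
by rewrite ger0_norm// normc_ge0.
Qed.

Lemma Cnormy_le f (m : R) : (Cnorm +oo%E f <= m%:E)%E <->
  \forall x \ae mu, normc (f x) <= m.
Proof.
rewrite CnormyE; split.
  by move=> /ess_supP; apply: aeS => x; rewrite lee_fin.
by move=> H; apply/ess_supP; apply: aeS H => x; rewrite lee_fin.
Qed.

Lemma Cnormy_ge0 f : (0 <= Cnorm +oo%E f)%E.
Proof. exact: Lnorm_ge0. Qed.

(** Trades the extended-real norms for a finite integral and an a.e. bound, which pass more directly
    through products and dilations. *)
Lemma L2LinfP f : L2Linf f <-> [/\ Cmeasurable f,
  (\int[mu]_x (normc (f x) ^+ 2)%:E < +oo)%E &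
  exists m, 0 <= m /\ \forall x \ae mu, normc (f x) <= m].
Proof.
rewrite /L2Linf; split => -[mf f2 fy]; split=> //.
- exact/Cnorm2_lty.
- have fN : Cnorm +oo%E f \is a fin_num by rewrite ge0_fin_numE ?Cnormy_ge0.
  exists (fine (Cnorm +oo%E f)); split; first by rewrite fine_ge0 ?Cnormy_ge0.
  by apply/Cnormy_le; rewrite fineK.
- exact/Cnorm2_lty.
- by case: fy => m [_ /Cnormy_le fm]; rewrite (le_lt_trans fm)// ltry.
Qed.

Lemma L2Linf_ae_le f (m : R) : (Cnorm +oo%E f < m%:E)%E ->
  exists r, [/\ 0 <= r, r < m & \forall x \ae mu, normc (f x) <= r].
Proof.
move=> fm; have fN : Cnorm +oo%E f \is a fin_num.
  by rewrite ge0_fin_numE ?Cnormy_ge0// (lt_trans fm)// ltry.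
exists (fine (Cnorm +oo%E f)); split; first by rewrite fine_ge0 ?Cnormy_ge0.
  by rewrite -lte_fin fineK.
by apply/Cnormy_le; rewrite fineK.
Qed.

(** The factor g is only assumed bounded, not square integrable, so that constants and f^n
    (including n = 0) are allowed. Scalar multiples and powers are then instances. *)
Lemma L2Linf_bounded_mul f g (m : R) : L2Linf f -> Cmeasurable g -> 0 <= m ->
  (\forall x \ae mu, normc (g x) <= m) -> L2Linf (fun x => g x * f x).
Proof.
move=> /L2LinfP[mf f2 [n [n0 fn]]] mg m0 gm; apply/L2LinfP; split.
- exact: Cmeasurable_mul.
- have mgf := Cmeasurable_mul mg mf.
  apply: (@le_lt_trans _ _ (\int[mu]_x ((m ^+ 2)%:E * (normc (f x) ^+ 2)%:E))%E).
    apply: ae_ge0_le_integral => //.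
    + by move=> x _; rewrite lee_fin sqr_ge0.
    + exact: measurable_sqr_normc.
    + by move=> x _; rewrite -EFinM lee_fin mulr_ge0 ?sqr_ge0.
    + by apply: emeasurable_funM => //; exact: measurable_sqr_normc.
    + apply: aeS gm => x gx _; rewrite -EFinM lee_fin Normc.normcM exprMn.
      by rewrite ler_wpM2r ?sqr_ge0// lerXn2r// nnegrE normc_ge0.
  rewrite ge0_integralZl//.
  + by rewrite lte_mul_pinfty// lee_fin sqr_ge0.
  + exact: measurable_sqr_normc.
  + by move=> x _; rewrite lee_fin sqr_ge0.
  + by rewrite lee_fin sqr_ge0.
- exists (m * n); split; first exact: mulr_ge0.
  apply: aeS2 gm fn => x gx fx.
  by rewrite Normc.normcM ler_pM ?normc_ge0.
Qed.

Lemma L2LinfZ (z : R[i]) f : L2Linf f -> L2Linf (fun x => z * f x).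
Proof.
move=> Lf; apply: (@L2Linf_bounded_mul f (fun=> z) (normc z)) => //.
- exact: normc_ge0.
- exact: aeW.
Qed.

(** Only positive powers: f^0 = 1 is not square integrable on the line. *)
Lemma L2Linf_exp f n : L2Linf f -> L2Linf (fun x => f x ^+ n.+1).
Proof.
move=> Lf; have /L2LinfP[mf _ [m [m0 fm]]] := Lf.
under eq_fun do rewrite exprSr.
apply: (@L2Linf_bounded_mul f (fun x => f x ^+ n) (m ^+ n)) => //.
- exact: Cmeasurable_exp.
- exact: exprn_ge0.
- by apply: aeS fm => x fx; rewrite normc_expn lerXn2r// nnegrE normc_ge0.
Qed.

Lemma integrable_sqr_normc f : L2Linf f ->
  mu.-integrable setT (fun x => (normc (f x) ^+ 2)%:E).
Proof.
move=> /L2LinfP[mf f2 _]; apply/integrableP; split; first exact: measurable_sqr_normc.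
under eq_integral do rewrite gee0_abs ?lee_fin ?sqr_ge0//.
exact: f2.
Qed.

(** Both components of conj(f) g are dominated by |f|^2 + |g|^2, as one sees by expanding the
    squares of sums and differences of real and imaginary parts. *)
Lemma L2inner_integrable f g : L2Linf f -> L2Linf g ->
  Cintegrable (fun s => Num.conj (f s) * g s).
Proof.
move=> Lf Lg; have [[mf _ _] [mg _ _]] := (Lf, Lg).
have ifg := integrableD measurableT (integrable_sqr_normc Lf) (integrable_sqr_normc Lg).
have [mre mim] := Cmeasurable_mul (Cmeasurable_conj mf) mg.
split; apply: le_integrable ifg => //.
- exact/measurable_EFinP.
- move=> x _ /=; rewrite lee_fin !sqr_normc_ReIm.
  rewrite [leRHS]ger0_norm; last by rewrite !addr_ge0// sqr_ge0.
  case: (f x) (g x) => p q [r s] /=; rewrite ler_norml.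
  have := (sqr_ge0 (p + r), sqr_ge0 (p - r), sqr_ge0 (q + s), sqr_ge0 (q - s)).
  have := (sqr_ge0 p, sqr_ge0 q, sqr_ge0 r, sqr_ge0 s).
  by move=> [[[? ?] ?] ?] [[[? ?] ?] ?]; apply/andP; split; nra.
- exact/measurable_EFinP.
- move=> x _ /=; rewrite lee_fin !sqr_normc_ReIm.
  rewrite [leRHS]ger0_norm; last by rewrite !addr_ge0// sqr_ge0.
  case: (f x) (g x) => p q [r s] /=; rewrite ler_norml.
  have := (sqr_ge0 (p + s), sqr_ge0 (p - s), sqr_ge0 (q + r), sqr_ge0 (q - r)).
  have := (sqr_ge0 p, sqr_ge0 q, sqr_ge0 r, sqr_ge0 s).
  by move=> [[[? ?] ?] ?] [[[? ?] ?] ?]; apply/andP; split; nra.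
Qed.

Lemma Re_L2inner f :
  complex.Re (L2inner f f) = Rintegral mu setT (fun x => normc (f x) ^+ 2).
Proof.
apply: eq_Rintegral => x _; rewrite sqr_normc_ReIm.
by case: (f x) => p q /=; ring.
Qed.

Lemma L2inner_ge0 f : 0 <= L2inner f f.
Proof. by apply: Cintegral_ge0 => x; rewrite mulrC mul_conjC_ge0. Qed.

(** Pointwise |f|^(2k+2) <= m^(2k) |f|^2. This geometric decay in k is what makes the exponential
    series converge. *)
Lemma L2inner_exp_le f (m : R) k : L2Linf f -> 0 <= m ->
  (\forall x \ae mu, normc (f x) <= m) ->
  complex.Re (L2inner (fun s => f s ^+ k.+1) (fun s => f s ^+ k.+1)) <=
  (m ^+ 2) ^+ k * complex.Re (L2inner f f).
Proof.
move=> Lf m0 fm; rewrite !Re_L2inner.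
have i1 := integrable_sqr_normc Lf.
have i2 := integrable_sqr_normc (L2Linf_exp k Lf).
rewrite -RintegralZl//; have i3 := integrableZl measurableT ((m ^+ 2) ^+ k) i1.
apply: fine_le; [exact: integrable_fin_num i2|exact: integrable_fin_num i3|].
apply: ae_ge0_le_integral => //.
- by move=> x _; rewrite lee_fin sqr_ge0.
- exact: measurable_int i2.
- by move=> x _; rewrite lee_fin mulr_ge0 ?sqr_ge0// exprn_ge0// sqr_ge0.
- exact: measurable_int i3.
- apply: aeS fm => x fx _; rewrite lee_fin normc_expn (exprAC (normc _)) exprSr.
  by rewrite ler_wpM2r ?sqr_ge0// !lerXn2r// ?nnegrE ?sqr_ge0// normc_ge0.
Qed.

End FunctionSpace.

(** * Weighted dilations: a common form for T and its adjoint *)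

Section WeightedDilation.
Context {R : realType}.
Local Notation mu := (@lebesgue_measure R).
Local Notation TR := (measurableTypeR R).
Local Notation normc := Normc.normc.
Implicit Types (f g : R -> R[i]) (a b : {posnum R}).

(** One family for both operators, so that every positivity argument is made once: (a, b) = (2, 1)
    gives T and (1/2, 1/2) gives its adjoint. *)
Definition wdil a b f : R -> R[i] := fun x => (b%:num)%:C * f (a%:num * x).

Lemma dilationE : @dilation R = wdil (2%:R)%:pos 1%:pos.
Proof. by apply/funext => f; apply/funext => x; rewrite /wdil mul1r. Qed.

Lemma dilation_adjE : @dilation_adj R = wdil (2^-1)%:pos (2^-1)%:pos.
Proof.
apply/funext => f; apply/funext => x.
by rewrite /wdil /dilation_adj [x / 2]mulrC fmorphV rmorph_nat.
Qed.

Lemma Cmeasurable_wdil a b f : Cmeasurable f -> Cmeasurable (wdil a b f).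
Proof.
move=> [mf nf]; apply: Cmeasurable_mul; first exact: Cmeasurable_cst.
split; first exact: (@measurable_fun_scale _ _ _ a _ mf).
exact: (@measurable_fun_scale _ _ _ a _ nf).
Qed.

Lemma sqr_normc_wdil a b f x : normc (wdil a b f x) ^+ 2 =
  b%:num ^+ 2 * normc (f (a%:num * x)) ^+ 2.
Proof. by rewrite Normc.normcM normc_real// exprMn. Qed.

(** The factor b^2 / a, amplitude squared times Jacobian, is at most 1 exactly when b^2 <= a. *)
Lemma integral_sqr_normc_wdil a b f : Cmeasurable f ->
  (\int[mu]_x (normc (wdil a b f x) ^+ 2)%:E =
   (b%:num ^+ 2 / a%:num)%:E * \int[mu]_x (normc (f x) ^+ 2)%:E)%E.
Proof.
move=> mf; under eq_integral do rewrite sqr_normc_wdil EFinM.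
have mh := measurable_sqr_normc mf.
rewrite ge0_integralZl//; last 2 first.
- exact: (@measurable_fun_scale _ _ _ a _ mh).
- by move=> x _; rewrite lee_fin sqr_ge0.
rewrite (@ge0_integral_scale _ a _ mh) ?EFinM ?muleA// => x.
by rewrite lee_fin sqr_ge0.
Qed.

Lemma ae_normc_wdil a b f (m : R) : (\forall x \ae mu, normc (f x) <= m) ->
  \forall x \ae mu, normc (wdil a b f x) <= b%:num * m.
Proof.
move=> /(@ae_scale _ a); apply: aeS => x.
by rewrite Normc.normcM normc_real// ler_pM2l.
Qed.

Lemma L2Linf_wdil a b f : L2Linf f -> L2Linf (wdil a b f).
Proof.
move=> /L2LinfP[mf f2 [m [m0 fm]]]; apply/L2LinfP; split.
- exact: Cmeasurable_wdil.
- by rewrite integral_sqr_normc_wdil// lte_mul_pinfty// lee_fin.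
- by exists (b%:num * m); split; [exact: mulr_ge0|exact: ae_normc_wdil].
Qed.

Lemma wdil_operator a b : L2Linf_operator (wdil a b).
Proof.
split; first exact: L2Linf_wdil.
- move=> f g _ _ /(@ae_scale _ a); apply: aeS => x H _.
  by rewrite /wdil H.
- by move=> z f g _ _; apply: aeW => x _; rewrite /wdil mulrDr mulrCA.
Qed.

Lemma wdil_contractiony a b : b%:num <= 1 -> norm_contraction +oo%E (wdil a b).
Proof.
move=> b1 f Lf; have [_ _ fy] := Lf.
have fN : Cnorm +oo%E f \is a fin_num by rewrite ge0_fin_numE ?Cnormy_ge0.
rewrite -(fineK fN); apply/Cnormy_le.
have : (Cnorm +oo%E f <= (fine (Cnorm +oo%E f))%:E)%E by rewrite fineK.
move=> /Cnormy_le/(@ae_normc_wdil a b); apply: aeS => x /le_trans; apply.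
by rewrite ler_piMl// fine_ge0// Cnormy_ge0.
Qed.

Lemma wdil_contraction2 a b : b%:num ^+ 2 <= a%:num ->
  norm_contraction 2%:E (wdil a b).
Proof.
move=> ba f [mf _ _]; rewrite !Cnorm2E integral_sqr_normc_wdil//.
have i0 : (0 <= \int[mu]_x (normc (f x) ^+ 2)%:E)%E.
  by apply: integral_ge0 => x _; rewrite lee_fin sqr_ge0.
apply: gt0_ler_poweR; rewrite ?invr_ge0// ?in_itv/= ?leey ?andbT ?mule_ge0//.
by rewrite -[leRHS]mul1e lee_wpmul2r// lee_fin ler_pdivrMr// mul1r.
Qed.

(** The amplitude enters to the power 2(k+1) but the Jacobian 1 / a only once. Each k thus has its
    own factor, which forces a term-by-term comparison of the kernels. *)
Lemma L2inner_exp_wdil a b f g k : L2Linf f -> L2Linf g ->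
  L2inner (fun s => wdil a b f s ^+ k.+1) (fun s => wdil a b g s ^+ k.+1) =
  ((b%:num ^+ 2) ^+ k.+1 / a%:num)%:C *
    L2inner (fun s => f s ^+ k.+1) (fun s => g s ^+ k.+1).
Proof.
move=> Lf Lg; have I := L2inner_integrable (L2Linf_exp k Lf) (L2Linf_exp k Lg).
rewrite rmorphM /= -mulrA -(@Cintegral_scale _ a _ I).
rewrite -CintegralZ; last first.
  exact: (@Cintegrable_scale _ a _ I).
congr Cintegral; apply/funext => x.
rewrite /wdil !exprMn rmorphM /= mulrACA; congr (_ * _).
rewrite -exprMn !rmorphXn /= rmorphM -exprMn; congr ((_ * _) ^+ _).
exact: conjc_real.
Qed.

Lemma dilation_adjP f g : L2Linf f -> L2Linf g ->
  L2inner (dilation_adj f) g = L2inner f (dilation g).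
Proof.
move=> Lf Lg; have Lg' : L2Linf (dilation g) by rewrite dilationE; exact: L2Linf_wdil.
have I := L2inner_integrable Lf Lg'.
(* Substitute x / 2 for x; the Jacobian 1/2 becomes the amplitude of the adjoint. *)
have -> : L2inner f (dilation g) =
    2^-1 * Cintegral (fun x => Num.conj (f (2^-1 * x)) * dilation g (2^-1 * x)).
  have := @Cintegral_scale _ (2^-1)%:pos _ I; rewrite /= => ->.
  by rewrite invrK rmorph_nat mulKf ?pnatr_eq0.
rewrite -CintegralZ; last first.
  exact: (@Cintegrable_scale _ (2^-1)%:pos _ I).
congr Cintegral; apply/funext => x.
rewrite /dilation /dilation_adj mulVKf ?pnatr_eq0// rmorphM mulrA [x / 2]mulrC.
by rewrite fmorphV rmorph_nat.
Qed.

End WeightedDilation.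

(** * Positive definite kernels on L^2 and L^oo functions *)

Section PositiveKernels.
Context {R : realType}.
Local Notation fT := (R -> R[i]).
Implicit Types (K : fT -> fT -> R[i]).

(** The test functions are confined to L^2 and L^oo because the Fock recursion holds only there. In
    R[i], [0 <=] also asserts that the double sum is real. *)
Definition posdef K : Prop := forall (I : finType) (a : I -> R[i]) (f : I -> fT),
  (forall i, L2Linf (f i)) ->
  0 <= \sum_i \sum_j Num.conj (a i) * a j * K (f i) (f j).

Lemma posdefD K1 K2 : posdef K1 -> posdef K2 ->
  posdef (fun f g => K1 f g + K2 f g).
Proof.
move=> p1 p2 I a f Lf; have := addr_ge0 (p1 I a f Lf) (p2 I a f Lf).
rewrite -big_split /=; under eq_bigr do rewrite -big_split /=.
by under [X in _ -> _ <= X]eq_bigr do under eq_bigr do rewrite mulrDr.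
Qed.

Lemma posdefZ (z : R[i]) K : 0 <= z -> posdef K -> posdef (fun f g => z * K f g).
Proof.
move=> z0 pK I a f Lf; have := mulr_ge0 z0 (pK I a f Lf).
rewrite mulr_sumr; under eq_bigr do rewrite mulr_sumr.
by under [X in _ -> _ <= X]eq_bigr do under eq_bigr do rewrite mulrCA.
Qed.

Lemma posdef0 : posdef (fun _ _ => 0).
Proof.
by move=> I a f _; rewrite big1// => i _; rewrite big1// => j _; rewrite mulr0.
Qed.

Lemma posdef_sum (I : Type) (s : seq I) (K : I -> fT -> fT -> R[i]) :
  (forall i, posdef (K i)) -> posdef (fun f g => \sum_(i <- s) K i f g).
Proof.
move=> pK; elim: s => [|i s IH].
  rewrite (_ : (fun _ _ => _) = fun _ _ => 0); first exact: posdef0.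
  by apply/funext => f; apply/funext => g; rewrite big_nil.
rewrite (_ : (fun _ _ => _) =
    fun f g => K i f g + \sum_(j <- s) K j f g); first exact: posdefD.
by apply/funext => f; apply/funext => g; rewrite big_cons.
Qed.

Lemma eq_posdef K1 K2 :
  (forall f g, L2Linf f -> L2Linf g -> K1 f g = K2 f g) ->
  posdef K1 -> posdef K2.
Proof.
move=> e p I a f Lf; have := p I a f Lf; congr (0 <= _).
by apply: eq_bigr => i _; apply: eq_bigr => j _; rewrite e.
Qed.

(* Schur product with the Gram kernel <f^k, g^k>, done pointwise under the
   integral sign. *)
Lemma posdef_L2inner_mul K k : posdef K -> posdef (fun f g =>
  L2inner (fun s => f s ^+ k.+1) (fun s => g s ^+ k.+1) * K f g).
Proof.
move=> pK T a f Lf.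
have I i j := L2inner_integrable (L2Linf_exp k (Lf i)) (L2Linf_exp k (Lf j)).
pose F i j x := Num.conj (a i) * a j * K (f i) (f j) *
  (Num.conj (f i x ^+ k.+1) * f j x ^+ k.+1).
have iF i j : Cintegrable (F i j) by exact: CintegrableZ.
have -> : \sum_i \sum_j Num.conj (a i) * a j * (L2inner (fun s => f i s ^+ k.+1)
    (fun s => f j s ^+ k.+1) * K (f i) (f j)) =
    Cintegral (fun x => \sum_i \sum_j F i j x).
  rewrite Cintegral_sum; last by move=> i; exact: Cintegrable_sum.
  apply: eq_bigr => i _; rewrite Cintegral_sum//; apply: eq_bigr => j _.
  by rewrite CintegralZ// -!mulrA [K _ _ * _]mulrC.
apply: Cintegral_ge0 => x.
have := pK T (fun i => a i * f i x ^+ k.+1) f Lf; congr (0 <= _).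
apply: eq_bigr => i _; apply: eq_bigr => j _; rewrite /F rmorphM/=.
ring.
Qed.

End PositiveKernels.

(** * The kernels <B_f^{+n} Phi, B_g^{+n} Phi> under weighted dilations *)

Section FockKernels.
Context {R : realType} {H : completeNormedModType R[i]} {c : R}.
Context {form : {dot H for Num.conj}} {Phi : H} {B : nat -> (R -> R[i]) -> H}.
Hypothesis c_gt0 : 0 < c.
Hypothesis fockH : quadratic_Fock c form Phi B.
Implicit Types (f g : R -> R[i]) (a b : {posnum R}).

Lemma braket_suml (I : Type) (s : seq I) (u : I -> H) (a : I -> R[i]) y :
  braket form (\sum_(i <- s) a i *: u i) y =
  \sum_(i <- s) Num.conj (a i) * braket form (u i) y.
Proof.
rewrite /braket linear_sumr; apply: eq_bigr => i _.
by rewrite linearZr_LR.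
Qed.

Lemma braket_sumr (I : Type) (s : seq I) (u : I -> H) (a : I -> R[i]) x :
  braket form x (\sum_(i <- s) a i *: u i) =
  \sum_(i <- s) a i * braket form x (u i).
Proof.
rewrite /braket linear_sumlz; apply: eq_bigr => i _.
by rewrite linearZl_LR.
Qed.

Lemma sqr_norm_sum (I : Type) (s : seq I) (u : I -> H) (a : I -> R[i]) :
  `|\sum_(i <- s) a i *: u i| ^+ 2 =
  \sum_(i <- s) \sum_(j <- s) Num.conj (a i) * a j * braket form (u i) (u j).
Proof.
rewrite (fock_norm fockH) braket_suml; apply: eq_bigr => i _.
by rewrite braket_sumr mulr_sumr; apply: eq_bigr => j _; rewrite mulrA.
Qed.

Definition Fock_kernel n f g : R[i] := braket form (B n f) (B n g).
Local Notation K := Fock_kernel.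

Lemma Fock_kernel0 f g : L2Linf f -> L2Linf g -> K 0 f g = 1.
Proof.
move=> Lf Lg; rewrite /K !(fock_B0 fockH)// -(fock_norm fockH).
by rewrite (fock_vacuum fockH) expr1n.
Qed.

(** All numerical factors of the recursion, c included, as one real number, so that its sign can be
    used. *)
Definition Fock_weight (n k : nat) : R :=
  c * 2 ^+ (2 * k + 1) * ((n`! * (n - 1)`!)%:R / ((n - k - 1)`! ^ 2)%:R).

Lemma Fock_weight_ge0 n k : 0 <= Fock_weight n k.
Proof. by rewrite !mulr_ge0 ?invr_ge0 ?exprn_ge0// ltW. Qed.

Lemma Fock_kernelS n f g : L2Linf f -> L2Linf g ->
  K n.+1 f g = \sum_(k < n.+1) (Fock_weight n.+1 k)%:C *
    (L2inner (fun s => f s ^+ k.+1) (fun s => g s ^+ k.+1) * K (n - k) f g).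
Proof.
move=> Lf Lg; rewrite /K (fock_inner fockH)// mulr_sumr; apply: eq_bigr => k _.
rewrite /Fock_weight !rmorphM /= fmorphV rmorphXn !rmorph_nat.
by rewrite subnAC subn1 /= !mulrA !(addn1 k) rmorphM /= !rmorph_nat.
Qed.

Lemma Fock_kernel_posdef n : posdef (K n).
Proof. by move=> m a f Lf; rewrite /K -sqr_norm_sum exprn_ge0. Qed.

Definition wdil_defect a b n f g := K n f g - K n (wdil a b f) (wdil a b g).

(** With K' the kernel after dilation, s K - th s K' = (1 - th) s K + th s (K - K'). This splitting
    has nonnegative coefficients when th <= 1 and involves only lower defects. *)
Lemma wdil_defectS a b n f g : L2Linf f -> L2Linf g ->
  let th k := (b%:num ^+ 2) ^+ k / a%:num in
  wdil_defect a b n.+1 f g = \sum_(k < n.+1) (Fock_weight n.+1 k)%:C *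
    ((1 - th k.+1)%:C * (L2inner (fun s => f s ^+ k.+1) (fun s => g s ^+ k.+1) *
        K (n - k) f g) +
     (th k.+1)%:C * (L2inner (fun s => f s ^+ k.+1) (fun s => g s ^+ k.+1) *
       wdil_defect a b (n - k) f g)).
Proof.
move=> Lf Lg /=; rewrite {1}/wdil_defect.
rewrite !Fock_kernelS//; try exact: L2Linf_wdil.
rewrite -sumrB; apply: eq_bigr => k _; rewrite L2inner_exp_wdil// /wdil_defect.
by rewrite rmorphB rmorph1; ring.
Qed.

Lemma wdil_defect_posdef a b n : b%:num <= 1 -> b%:num ^+ 2 <= a%:num ->
  posdef (wdil_defect a b n).
Proof.
move=> b1 ba; elim/ltn_ind: n => -[_|n IH].
  refine (@eq_posdef _ (fun _ _ => 0) _ _ (@posdef0 R)) => f g Lf Lg.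
  by rewrite /wdil_defect !Fock_kernel0 ?subrr//; exact: L2Linf_wdil.
refine (eq_posdef (fun f g Lf Lg => esym (wdil_defectS a b n Lf Lg)) _).
apply: posdef_sum => k; apply: posdefZ; first by rewrite ler0c Fock_weight_ge0.
(* Since b <= 1, b^(2(k+1)) = b^2 b^(2k) <= b^2 <= a. *)
have t1 : (b%:num ^+ 2) ^+ k.+1 / a%:num <= 1.
  rewrite ler_pdivrMr// mul1r (le_trans _ ba)// exprS.
  by rewrite ler_piMr ?sqr_ge0// exprn_ile1// ?sqr_ge0// exprn_ile1.
apply: posdefD; apply: posdefZ; rewrite ?ler0c ?subr_ge0//.
- by apply: posdef_L2inner_mul; exact: Fock_kernel_posdef.
- by apply: posdef_L2inner_mul; apply: IH; rewrite ltnS leq_subr.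
Qed.

Lemma L2inner_expZ (y z : R[i]) k f g : L2Linf f -> L2Linf g ->
  L2inner (fun s => (y * f s) ^+ k.+1) (fun s => (z * g s) ^+ k.+1) =
  (Num.conj y * z) ^+ k.+1 *
    L2inner (fun s => f s ^+ k.+1) (fun s => g s ^+ k.+1).
Proof.
move=> Lf Lg; rewrite /L2inner -CintegralZ; last first.
  exact: (L2inner_integrable (L2Linf_exp k Lf) (L2Linf_exp k Lg)).
congr Cintegral; apply/funext => x.
by rewrite !exprMn rmorphM rmorphXn mulrACA.
Qed.

Lemma Fock_kernelZ (y z : R[i]) n f g : L2Linf f -> L2Linf g ->
  K n (fun s => y * f s) (fun s => z * g s) = (Num.conj y * z) ^+ n * K n f g.
Proof.
move=> Lf Lg; have [Ly Lz] := (L2LinfZ y Lf, L2LinfZ z Lg).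
elim/ltn_ind: n => -[_|n IH]; first by rewrite !Fock_kernel0// expr0 mulr1.
rewrite !Fock_kernelS// mulr_sumr; apply: eq_bigr => k _.
rewrite L2inner_expZ// IH ?ltnS ?leq_subr//.
(* The degree k+1 of the inner product of powers and the degree n-k of the lower kernel add up to
   n+1. *)
have -> : (Num.conj y * z) ^+ n.+1 =
    (Num.conj y * z) ^+ k.+1 * (Num.conj y * z) ^+ (n - k).
  by rewrite -exprD addSn subnKC// -ltnS.
ring.
Qed.

(** The vectors are known through their inner products only, so homogeneity is obtained by expanding
    the squared norm of the difference, which vanishes. *)
Lemma FockZ (z : R[i]) n f : L2Linf f ->
  B n (fun s => z * f s) = z ^+ n *: B n f.
Proof.
move=> Lf; have Lz := L2LinfZ z Lf.
(* Reading f as 1 * f lets the two-sided scaling law treat the mixed terms. *)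
have e : f = (fun s => 1 * f s) by apply/funext => s; rewrite mul1r.
have K1 : K n (fun s => z * f s) f = Num.conj z ^+ n * K n f f.
  by rewrite [X in K n _ X = _]e Fock_kernelZ// mulr1.
have K2 : K n f (fun s => z * f s) = z ^+ n * K n f f.
  by rewrite [X in K n X _ = _]e Fock_kernelZ// rmorph1 mul1r.
apply/eqP; rewrite -subr_eq0 -normr_eq0 -sqrf_eq0.
have -> : B n (fun s => z * f s) - z ^+ n *: B n f =
    \sum_(i < 2) (if i == 0 then 1 else - z ^+ n) *:
      (B n (if i == 0 then (fun s => z * f s) else f)).
  by rewrite !big_ord_recl big_ord0 /= addr0 scale1r scaleNr.
rewrite sqr_norm_sum !big_ord_recl !big_ord0 /= !addr0 -!/(Fock_kernel _ _ _).
rewrite K1 K2 Fock_kernelZ// rmorphN rmorphXn rmorph1 exprMn.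
by apply/eqP; ring.
Qed.

End FockKernels.

(** * Continuous extension of a densely defined contraction *)

Section ContractionExtension.
Context {R : realType} {H : completeNormedModType R[i]}.

Lemma gt0_real_complex (e : R[i]) : 0 < e -> exists2 r : R, 0 < r & e = r%:C.
Proof.
case: e => x y; rewrite ltcE /= => /andP[/eqP -> x0]; exists x => //.
Qed.

Lemma natSinv_complex n : (n.+1%:R^-1 : R[i]) = (n.+1%:R^-1)%:C.
Proof. by rewrite fmorphV rmorph_nat. Qed.

Lemma near_natSinv_lt_complex (e : R[i]) : 0 < e ->
  \forall n \near \oo, (n.+1%:R^-1 : R[i]) < e.
Proof.
move=> /gt0_real_complex[r r0 ->].
have := near_infty_natSinv_lt (PosNum r0); apply: filterS => n /= h.
by rewrite natSinv_complex ltcR.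
Qed.

(** The order of R[i] is partial; both sides must be real for the negation of x <= y to give y <
    x. *)
Lemma le_addgt0_complex (x y : R[i]) : x \is Num.real -> y \is Num.real ->
  (forall e, 0 < e -> x <= y + e) -> x <= y.
Proof.
move=> xr yr h; rewrite real_leNgt//; apply/negP => yx.
have e0 : 0 < (x - y) / 2 by rewrite divr_gt0// subr_gt0.
have := h _ e0; rewrite -subr_ge0.
rewrite (_ : _ - _ = - ((x - y) / 2)); last by field.
by rewrite oppr_ge0 lt_geF.
Qed.

(** [D] is a relation because a vector may be written in many ways as a combination of generators.
    Linearity and contractivity make the closure [E] of its graph single-valued; density and
    completeness make it total. *)
Lemma contraction_extension (D : H -> H -> Prop) :
  (forall z x y x' y', D x y -> D x' y' -> D (z *: x + x') (z *: y + y')) ->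
  (forall x y, D x y -> `|y| <= `|x|) ->
  closure [set x | exists y, D x y] = setT ->
  exists G : {linear H -> H}, continuous G /\ forall x y, D x y -> G x = y.
Proof.
move=> Dlin Dle Ddense.
pose E x y := forall e : R[i], 0 < e ->
  exists u v, [/\ D u v, `|x - u| < e & `|y - v| < e].
have DE x y : D x y -> E x y.
  by move=> Dxy e e0; exists x, y; split => //; rewrite subrr normr0.
have Elin z x y x' y' : E x y -> E x' y' -> E (z *: x + x') (z *: y + y').
  (* The summand 1 keeps the tolerance e / 2 / (|z| + 1) meaningful for z = 0. *)
  move=> Exy Exy' e e0; have z0 : 0 < `|z| + 1 by rewrite ltr_wpDl.
  have [u [v [Duv xu yv]]] := Exy _ (divr_gt0 (divr_gt0 e0 (ltr0Sn _ 1)) z0).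
  have [u' [v' [Duv' xu' yv']]] := Exy' _ (divr_gt0 e0 (ltr0Sn _ 1)).
  have est (p q p' q' : H) : `|p - q| < e / 2 / (`|z| + 1) -> `|p' - q'| < e / 2 ->
      `|z *: p + p' - (z *: q + q')| < e.
    rewrite ltr_pdivlMr// => h1 h2.
    rewrite opprD addrACA -scalerBr (le_lt_trans (ler_normD _ _))// normrZ.
    rewrite [ltRHS](splitr e) ler_ltD// ltW// (le_lt_trans _ h1)// mulrC.
    by rewrite ler_wpM2l// lerDl.
  exists (z *: u + u'), (z *: v + v'); split; [exact: Dlin|exact: est|exact: est].
have Ele x y : E x y -> `|y| <= `|x|.
  move=> Exy; apply: le_addgt0_complex => // e e0.
  have [u [v [Duv xu yv]]] := Exy _ (divr_gt0 e0 (ltr0Sn _ 1)).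
  have h1 : `|y| <= `|y - v| + `|v| by rewrite -{1}(subrK v y) ler_normD.
  have h2 : `|u| <= `|x - u| + `|x| by rewrite distrC -{1}(subrK x u) ler_normD.
  apply: (le_trans h1); rewrite [e]splitr [leRHS]addrC -addrA lerD ?(ltW yv)//.
  apply: le_trans (Dle _ _ Duv) _; apply: (le_trans h2).
  by rewrite lerD2r ltW.
have Efun x y y' : E x y -> E x y' -> y = y'.
  (* By linearity [E] relates x - x = 0 to y' - y, whose norm is therefore at most 0. *)
  move=> Exy Exy'; apply/eqP; rewrite eq_sym -subr_eq0 -normr_le0.
  rewrite -(normr0 H) -(subrr x).
  have := Ele _ _ (Elin (-1) _ _ _ _ Exy Exy').
  by rewrite !scaleN1r addrC [- x + _]addrC.
have Etot x : exists y, E x y.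
  have {}Ddense n : exists uv : H * H, D uv.1 uv.2 /\ `|x - uv.1| < n.+1%:R^-1.
    have : closure [set x | exists y, D x y] x by rewrite Ddense.
    have n0 : 0 < (n.+1%:R^-1 : R[i]) by rewrite invr_gt0.
    move=> /(_ _ (nbhsx_ballx x _ n0))[u [[v Duv]]].
    by rewrite -ball_normE /= => xu; exists (u, v).
  have [w hw] := choice Ddense.
  (* The first components approach x at rate 1 / (n+1), and [D] contracts differences, so the second
     components are Cauchy. *)
  have wC : cauchy ((fun n => (w n).2) @ \oo).
    apply: cauchy_exP => e e0.
    have [N _ hN] := near_natSinv_lt_complex (divr_gt0 e0 (ltr0Sn _ 1)).
    exists (w N).2; exists N => // n /= Nn; rewrite -ball_normE /=.
    have [[DN xN] [Dn xn]] := (hw N, hw n).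
    have := Dle _ _ (Dlin (-1) _ _ _ _ Dn DN); rewrite !scaleN1r ![- _ + _]addrC.
    move=> /le_lt_trans; apply.
    rewrite -(subrK x (w N).1) -addrA (le_lt_trans (ler_normD _ _))//.
    rewrite (splitr e) ltrD//; last exact: lt_trans (hN _ Nn).
    by rewrite distrC (lt_trans xN)// hN /=.
  have /cauchy_cvgP wc := wC.
  exists (lim ((fun n => (w n).2) @ \oo)) => e e0.
  have h1 := near_natSinv_lt_complex e0.
  move/cvgrPdist_lt : wc => /(_ _ e0) h2.
  have [N _ hN] := filterI h1 h2.
  have [N1 N2] := hN N (leqnn _); have [DN xN] := hw N.
  by exists (w N).1, (w N).2; split => //; exact: lt_trans N1.
have [G GE] := choice Etot.
have linG : linear G.
  by move=> z x y; apply: Efun (GE _) (Elin _ _ _ _ _ (GE x) (GE y)).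
pose mG := GRing.isLinear.Build R[i] H H *:%R G linG.
pose G' : {linear H -> H} := HB.pack G mG.
exists G'; split; last by move=> x y /DE; exact: Efun.
move=> x; apply/cvgrPdist_lt => e e0.
near do rewrite -linearB (le_lt_trans (Ele _ _ (GE _)))//.
Unshelve. all: by end_near. Qed.

End ContractionExtension.

(** * Geometric decay from a convolution recursion *)

Section GeometricBounds.
Context {R : realType}.

(** Take s strictly between r and 1. Once n+1 >= C / (s - r), the factor n+1 on the left absorbs C,
    and sum_k r^k s^(n-k) <= s^(n+1) / (s - r) closes the induction. The constant M takes care of
    the first N terms. *)
Lemma recursion_geometric_bound (u : nat -> R) (C r : R) :
  (forall n, 0 <= u n) -> 0 <= r -> r < 1 -> 0 <= C ->
  (forall n, n.+1%:R * u n.+1 <= C * \sum_(k < n.+1) r ^+ k * u (n - k)%N) ->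
  exists M s, [/\ 0 <= M, 0 <= s, s < 1 & forall n, u n <= M * s ^+ n].
Proof.
move=> u0 r0 r1 C0 urec; pose s := (1 + r) / 2.
have s0 : 0 < s by rewrite /s; lra.
have s1 : s < 1 by rewrite /s; lra.
have rs : r < s by rewrite /s; lra.
pose N := (Num.truncn (C / (s - r))).+1.
have CN : C / (s - r) <= N%:R by exact/ltW/truncnS_gt.
pose M := \sum_(j < N) u j / s ^+ j.
have M0 : 0 <= M by apply: sumr_ge0 => j _; rewrite divr_ge0// exprn_ge0// ltW.
exists M, s; split; [exact: M0|exact: ltW|exact: s1|].
elim/ltn_ind => n IH; have [nN|Nn] := ltnP n N.
  rewrite -ler_pdivrMr ?exprn_gt0// /M (bigD1 (Ordinal nN))//= lerDl.
  by apply: sumr_ge0 => j _; rewrite divr_ge0// exprn_ge0// ltW.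
case: n Nn IH => // n Nn IH.
have sr0 : 0 < s - r by rewrite subr_gt0.
pose G := \sum_(k < n.+1) r ^+ k * s ^+ (n - k).
have uG : \sum_(k < n.+1) r ^+ k * u (n - k)%N <= M * G.
  rewrite mulr_sumr; apply: ler_sum => k _; rewrite mulrCA.
  by rewrite ler_wpM2l ?exprn_ge0// IH// ltnS leq_subr.
(* Telescoping: (s - r) G = s^(n+1) - r^(n+1). *)
have Gs : (s - r) * G <= s ^+ n.+1.
  rewrite /G; under eq_bigr do rewrite mulrC.
  by have := subrXX s r n.+1; rewrite /= => <-; rewrite gerBl exprn_ge0.
have Cn : C <= n.+1%:R * (s - r).
  rewrite -ler_pdivrMr//; apply: le_trans CN _; by rewrite ler_nat.
rewrite -(@ler_pM2l _ (n.+1%:R * (s - r))) ?mulr_gt0//.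
rewrite mulrAC; apply: (@le_trans _ _ (C * (M * G) * (s - r))).
  by rewrite ler_wpM2r ?(ltW sr0)// (le_trans (urec n))// ler_wpM2l.
apply: (@le_trans _ _ (C * (M * s ^+ n.+1))).
  by rewrite -mulrA ler_wpM2l// -mulrA ler_wpM2l// mulrC.
by rewrite ler_wpM2r// mulr_ge0// exprn_ge0// ltW.
Qed.

End GeometricBounds.

(** * Real-valued norms and power series with coefficients in H *)

Section Norms.
Context {R : realType} {H : completeNormedModType R[i]}.

(** The norm of H takes values in R[i]; estimates with square roots and geometric series are carried
    out in R. *)
Definition rnorm (x : H) : R := complex.Re `|x|.

Lemma rnormE x : `|x| = (rnorm x)%:C.
Proof. by rewrite /rnorm RRe_real. Qed.

Lemma rnorm_ge0 x : 0 <= rnorm x.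
Proof. by rewrite -ler0c -rnormE. Qed.

Lemma rnorm_sum (I : Type) (s : seq I) (P : pred I) (u : I -> H) :
  rnorm (\sum_(i <- s | P i) u i) <= \sum_(i <- s | P i) rnorm (u i).
Proof.
rewrite -lecR -rnormE rmorph_sum (le_trans (ler_norm_sum _ _ _))//=.
by apply: ler_sum => i _; rewrite rnormE.
Qed.

Lemma rnormD x y : rnorm (x + y) <= rnorm x + rnorm y.
Proof. by rewrite -lecR rmorphD /= -!rnormE ler_normD. Qed.

Lemma rnormZ (r : R) x : 0 <= r -> rnorm (r%:C *: x) = r * rnorm x.
Proof.
move=> r0; apply: (@complexI R); rewrite rmorphM /= -!rnormE normrZ.
by rewrite ger0_norm// ler0c.
Qed.

Lemma rnorm_eq0 x : rnorm x <= 0 -> x = 0.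
Proof. by rewrite -lecR -rnormE normr_le0 => /eqP. Qed.

Lemma geometric_cvg_series (u : nat -> H) (M s : R) : 0 <= s -> s < 1 ->
  (forall n, rnorm (u n) <= M * s ^+ n) -> cvg (series u @ \oo).
Proof.
move=> s0 s1 uM.
have : cvg (series (geometric M s) @ \oo).
  by apply: is_cvg_geometric_series; rewrite ger0_norm.
move=> /cauchy_cvgP/cauchy_seriesP gC.
apply/cauchy_cvgP/cauchy_seriesP => e /gt0_real_complex[r r0 ->].
apply: filterS (gC _ r0) => -[m n] /= h; rewrite rnormE ltcR.
apply: le_lt_trans h; rewrite (le_trans (rnorm_sum _ _ _))//.
by rewrite (le_trans _ (ler_norm _))// ler_sum.
Qed.

Lemma rnorm_near0 (u : nat -> H) (e : R) : 0 < e -> u @ \oo --> 0 ->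
  \forall n \near \oo, rnorm (u n) < e.
Proof.
move=> e0 /cvgr0Pnorm_lt/(_ e%:C); rewrite ltcR => /(_ e0).
by apply: filterS => n; rewrite rnormE ltcR.
Qed.

(** Convergence at t = 1 bounds all coefficients by some M. If those below n vanish, then for t <=
    1/2 the terms after t^n v_n add up to at most 2 M t^(n+1), so v_n has norm O(t). *)
Lemma power_series_eq0 (v : nat -> H) :
  (forall t : R, 0 < t -> t <= 1 ->
    series (fun n => (t ^+ n)%:C *: v n) @ \oo --> 0) ->
  forall n, v n = 0.
Proof.
move=> vt; have [M M0 vM] : exists2 M : R, 0 < M & forall k, rnorm (v k) <= M.
  have := vt 1 ltr01 (lexx _).
  under [X in series X]eq_fun do rewrite expr1n rmorph1 scale1r.
  move=> c1; have /cvg_series_cvg_0 c0 : cvgn (series v) by apply/cvg_ex; exists 0.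
  have [N _ hN] := rnorm_near0 ltr01 c0.
  exists (1 + \sum_(j < N) rnorm (v j)).
    by rewrite ltr_pwDl// sumr_ge0// => j _; exact: rnorm_ge0.
  move=> k; have [kN|Nk] := ltnP k N.
    rewrite (bigD1 (Ordinal kN))//= addrCA lerDl addr_ge0// sumr_ge0// => j _.
    exact: rnorm_ge0.
  rewrite (le_trans (ltW (hN _ Nk)))// lerDl sumr_ge0// => j _; exact: rnorm_ge0.
elim/ltn_ind => n IH; apply: rnorm_eq0; apply/ler_addgt0Pr => e e0; rewrite add0r.
(* The bound 1/2 makes the geometric sum at most 2; the bound e / (4 M) then makes the tail at most
   t^n e / 2. *)
pose t := Num.min (2^-1) (e / (4 * M)).
have t0 : 0 < t by rewrite lt_min invr_gt0 ltr0n divr_gt0// mulr_gt0.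
have t2 : t <= 2^-1 by rewrite ge_min lexx.
have tM : t * (4 * M) <= e by rewrite -ler_pdivlMr ?mulr_gt0// ge_min lexx orbT.
have t1 : t <= 1 by lra.
have te : 0 < t ^+ n * (e / 2) by rewrite mulr_gt0 ?exprn_gt0// divr_gt0.
have t0' := ltW t0.
have [N _ hN] := rnorm_near0 te (vt _ t0 t1).
(* A partial sum of this length consists of n vanishing terms, the term of index n and N further
   ones. *)
have := hN (N + n.+1)%N (leq_addr _ _).
rewrite /series /= addnC big_mkord big_split_ord/= big_ord_recr/=.
rewrite big1 ?add0r; last by move=> i _; rewrite IH ?scaler0.
set T := \sum_(i < N) _ => h.
have T2 : rnorm T <= t ^+ n * (e / 2).
  apply: le_trans (rnorm_sum _ _ _) _.
  apply: (@le_trans _ _ (\sum_(i < N) t ^+ n * (t * M) * t ^+ i)).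
    apply: ler_sum => i _; rewrite rnormZ ?exprn_ge0//.
    have -> : t ^+ n * (t * M) * t ^+ i = t ^+ (n.+1 + i) * M.
      by rewrite exprD exprS; ring.
    by rewrite ler_wpM2l ?exprn_ge0.
  rewrite -mulr_sumr -mulrA ler_pM2l ?exprn_gt0//.
  have : (1 - t) * \sum_(i < N) t ^+ i <= 1.
    have := subrX1 t N; have := exprn_ge0 N (ltW t0); nra.
  set S := \sum_(i < N) _ => S1.
  have S0 : 0 <= S by apply: sumr_ge0 => i _; rewrite exprn_ge0.
  have S2 : S <= 2.
    by have : 0 <= (2^-1 - t) * S by [rewrite mulr_ge0// subr_ge0]; lra.
  have tM0 : 0 <= t * M by rewrite mulr_ge0// ltW.
  by have := ler_wpM2l tM0 S2; lra.
have := rnormD ((t ^+ n)%:C *: v n + T) (- T); rewrite addrK.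
rewrite rnormZ ?exprn_ge0//.
have -> : rnorm (- T) = rnorm T by rewrite /rnorm normrN.
move=> h2; have h3 := lerD (ltW h) T2; have := le_trans h2 h3.
by rewrite -mulrDr ler_pM2l ?exprn_gt0// -splitr.
Qed.

End Norms.

(** * Quantizing weighted dilations *)

Section Quantization.
Context {R : realType} {H : completeNormedModType R[i]} {c : R}.
Context {form : {dot H for Num.conj}} {Phi : H} {B : nat -> (R -> R[i]) -> H}.
Hypothesis c_gt0 : 0 < c.
Hypothesis fockH : quadratic_Fock c form Phi B.
Local Notation mu := (@lebesgue_measure R).
Local Notation normc := Normc.normc.
Local Notation fT := (R -> R[i]).
Implicit Types (f g : R -> R[i]) (a b : {posnum R}).

(** Orthogonality of different n splits the difference of the squared norms into one quadratic form
    of [wdil_defect] per level, and each is nonnegative. *)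
Lemma Fock_sum_contraction a b (I : finType) (z : I -> R[i]) (n : I -> nat)
    (f : I -> fT) : b%:num <= 1 -> b%:num ^+ 2 <= a%:num ->
  (forall i, L2Linf (f i)) ->
  `|\sum_i z i *: B (n i) (wdil a b (f i))| <= `|\sum_i z i *: B (n i) (f i)|.
Proof.
move=> b1 ba Lf; rewrite -(@ler_pXn2r _ 2)// ?nnegrE//.
rewrite !(sqr_norm_sum fockH) -subr_ge0 -sumrB.
under eq_bigr do rewrite -sumrB.
pose N := (\max_i n i).+1.
(* Coefficients cut off outside level m; a pair i, j then contributes only if both lie on the same
   level. *)
pose zm (m : nat) i : R[i] := if n i == m then z i else 0.
suff -> : \sum_i \sum_j
    (Num.conj (z i) * z j * braket form (B (n i) (f i)) (B (n j) (f j)) -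
     Num.conj (z i) * z j *
      braket form (B (n i) (wdil a b (f i))) (B (n j) (wdil a b (f j)))) =
    \sum_(m < N) \sum_i \sum_j Num.conj (zm m i) * zm m j *
      wdil_defect (form := form) (B := B) a b m (f i) (f j).
  by apply: sumr_ge0 => m _; exact: (wdil_defect_posdef c_gt0 fockH m b1 ba).
rewrite [RHS]exchange_big; apply: eq_bigr => i _; rewrite [RHS]exchange_big.
apply: eq_bigr => j _.
have iN : (n i < N)%N by rewrite ltnS leq_bigmax.
rewrite (bigD1 (Ordinal iN))//= big1 ?addr0 => [|m mi]; last first.
  rewrite /zm ifN ?rmorph0 ?mul0r//; apply: contra mi => /eqP im.
  by apply/eqP/val_inj; rewrite /= im.
rewrite /zm eqxx -mulrBr; case: ifPn => [/eqP ->//|nij].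
have ij : n i <> n j by move=> e; rewrite e eqxx in nij.
rewrite !(fock_orth fockH) ?subr0 ?mulr0 ?mul0r//; exact: L2Linf_wdil.
Qed.

Lemma wdil_quantization_exists a b : b%:num <= 1 -> b%:num ^+ 2 <= a%:num ->
  exists G : {linear H -> H}, continuous G /\
    forall n f, L2Linf f -> G (B n f) = B n (wdil a b f).
Proof.
move=> b1 ba.
pose D x y := exists (I : finType) (z : I -> R[i]) (n : I -> nat) (f : I -> fT),
  [/\ forall i, L2Linf (f i), x = \sum_i z i *: B (n i) (f i) &
      y = \sum_i z i *: B (n i) (wdil a b (f i))].
have [||| G [cG GD]] := @contraction_extension R H D.
- move=> t _ _ _ _ [I [z [n [f [Lf -> ->]]]]] [J [z' [n' [f' [Lf' -> ->]]]]].
  (* The disjoint union of the index types concatenates the two combinations. *)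
  exists (I + J)%type, (fun k => match k with inl i => t * z i | inr j => z' j end),
    (fun k => match k with inl i => n i | inr j => n' j end),
    (fun k => match k with inl i => f i | inr j => f' j end).
  split; first by case.
  + rewrite big_sumType/= scaler_sumr; congr (_ + _).
    by apply: eq_bigr => i _; rewrite scalerA.
  + rewrite big_sumType/= scaler_sumr; congr (_ + _).
    by apply: eq_bigr => i _; rewrite scalerA.
- by move=> _ _ [I [z [n [f [Lf -> ->]]]]]; exact: Fock_sum_contraction.
- apply/seteqP; split => // x _; have := fock_total fockH.
  move=> /seteqP[_ /(_ x I)]; apply: closure_subset => _ [m [z [u [Au ->]]]].
  have [w hw] := choice (fun i => let: ex_intro n (ex_intro f h) := Au i in
    ex_intro (fun nf => L2Linf nf.2 /\ u i = B nf.1 nf.2) (n, f) h).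
  exists (\sum_i z i *: B (w i).1 (wdil a b (w i).2)).
  exists 'I_m, z, (fun i => (w i).1), (fun i => (w i).2); split => //.
    by move=> i; have [] := hw i.
  by apply: eq_bigr => i _; have [_ ->] := hw i.
- exists G; split => // n f Lf; apply: GD.
  exists unit, (fun=> 1), (fun=> n), (fun=> f); split => //.
    by rewrite big_const card_unit /= addr0 scale1r.
  by rewrite big_const card_unit /= addr0 scale1r.
Qed.

(** The theorem concerns every bounded operator with the prescribed values, not just the constructed
    one; contractivity passes from the dense span to H by continuity. *)
Lemma wdil_quantization_contraction a b (G : {linear H -> H}) :
  b%:num <= 1 -> b%:num ^+ 2 <= a%:num -> continuous G ->
  (forall n f, L2Linf f -> G (B n f) = B n (wdil a b f)) -> contraction_op G.
Proof.
move=> b1 ba cG GB x; apply: le_addgt0_complex => // e e0.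
have e2 : 0 < e / 2 by rewrite divr_gt0.
have := fock_total fockH; move=> /seteqP[_ /(_ x I)] clx.
have n1 : \forall u \near x, `|x - u| < e / 2 by exact: cvgr_dist_lt.
have n2 : \forall u \near x, `|G x - G u| < e / 2.
  by move/cvgrPdist_lt: (cG x) => /(_ _ e2).
have [_ [[m [z [u [Au ->]]]] [/= h1 h2]]] := clx _ (filterI n1 n2).
set v := \sum_i _ in h1 h2.
have Gv : `|G v| <= `|v|.
  have [w hw] := choice (fun i => let: ex_intro n (ex_intro f h) := Au i in
    ex_intro (fun nf => L2Linf nf.2 /\ u i = B nf.1 nf.2) (n, f) h).
  have -> : v = \sum_i z i *: B (w i).1 (w i).2.
    by apply: eq_bigr => i _; have [_ ->] := hw i.
  have Lw i : L2Linf (w i).2 by have [] := hw i.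
  rewrite linear_sum; under eq_bigr do rewrite linearZ /= GB//.
  exact: Fock_sum_contraction.
have k1 : `|G x| <= `|G x - G v| + `|G v| by rewrite -{1}(subrK (G v) (G x)) ler_normD.
have k2 : `|v| <= `|x - v| + `|x| by rewrite distrC -{1}(subrK x v) ler_normD.
apply: (le_trans k1); rewrite [e]splitr [leRHS]addrC -addrA lerD ?(ltW h2)//.
by apply: (le_trans Gv); apply: (le_trans k2); rewrite lerD2r ltW.
Qed.

(** For u_n = |B_n f|^2 / n!^2 the weights of the recursion become 2 c 4^k, and |f| <= m makes it
    geometric of ratio 4 m^2. This is below 1 because m < 1/2. *)
Lemma Fock_norm_le f (m : R) : L2Linf f -> 0 <= m -> m < 2^-1 ->
  (\forall x \ae mu, normc (f x) <= m) ->
  exists M s, [/\ 0 <= s, s < 1 &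
    forall n, rnorm ((n`!%:R)^-1 *: B n f) <= M * s ^+ n].
Proof.
move=> Lf m0 m2 fm.
pose u n := rnorm ((n`!%:R)^-1 *: B n f) ^+ 2.
have uE n : u n = complex.Re (Fock_kernel (form := form) (B := B) n f f) / n`!%:R ^+ 2.
  rewrite /u (_ : (n`!%:R)^-1 = ((n`!%:R)^-1)%:C); last by rewrite fmorphV rmorph_nat.
  rewrite rnormZ ?invr_ge0// exprMn exprVn mulrC; congr (_ / _).
  rewrite /Fock_kernel -(fock_norm fockH) rnormE.
  by rewrite -rmorphXn.
pose s0 := complex.Re (L2inner f f).
have s00 : 0 <= s0 by have := L2inner_ge0 f; rewrite lecE => /andP[].
have u0 n : 0 <= u n by exact: sqr_ge0.
have r0 : 0 <= 4 * m ^+ 2 by rewrite mulr_ge0// sqr_ge0.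
have r1 : 4 * m ^+ 2 < 1 by nra.
have C0 : 0 <= 2 * c * s0 by rewrite !mulr_ge0// ltW.
have urec n : n.+1%:R * u n.+1 <=
    2 * c * s0 * \sum_(k < n.+1) (4 * m ^+ 2) ^+ k * u (n - k)%N.
  have fact_neq0 j : j`!%:R != 0 :> R by rewrite pnatr_eq0 -lt0n fact_gt0.
  have KE j : Fock_kernel (form := form) (B := B) j f f = (j`!%:R ^+ 2 * u j)%:C.
    rewrite uE mulrC divfK ?expf_neq0// RRe_real// /Fock_kernel -(fock_norm fockH).
    by rewrite realX.
  pose sg k := complex.Re (L2inner (fun s => f s ^+ k.+1) (fun s => f s ^+ k.+1)).
  have sE k : L2inner (fun s => f s ^+ k.+1) (fun s => f s ^+ k.+1) = (sg k)%:C.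
    by rewrite RRe_real// ger0_real// L2inner_ge0.
  have := Fock_kernelS fockH n Lf Lf; rewrite KE.
  under eq_bigr do rewrite KE sE -!rmorphM; rewrite -rmorph_sum => /complexI E.
  (* Dividing by (n+1)! n! instead of (n+1)!^2 leaves the factor n+1 that the geometric bound relies
     on. *)
  have -> : n.+1%:R * u n.+1 =
      ((n.+1)`!%:R ^+ 2 * u n.+1) / ((n.+1)`!%:R * n`!%:R).
    rewrite factS natrM; field.
    by rewrite fact_neq0 addrC natr1 pnatr_eq0.
  rewrite E mulr_suml mulr_sumr; apply: ler_sum => k _.
  have -> : Fock_weight (c := c) n.+1 k * (sg k * ((n - k)`!%:R ^+ 2 * u (n - k)%N)) /
      ((n.+1)`!%:R * n`!%:R) = 2 * c * 4 ^+ k * u (n - k)%N * sg k.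
    rewrite /Fock_weight subnAC !subn1 /= natrM natrX exprD exprM expr1.
    rewrite (_ : 2 ^+ 2 = 4); last by rewrite -natrX.
    by field; rewrite !fact_neq0.
  have -> : 2 * c * s0 * ((4 * m ^+ 2) ^+ k * u (n - k)%N) =
      2 * c * 4 ^+ k * u (n - k)%N * ((m ^+ 2) ^+ k * s0).
    by rewrite [(4 * _) ^+ _]exprMn; ring.
  have w0 : 0 <= 2 * c * 4 ^+ k * u (n - k)%N.
    by rewrite mulr_ge0// mulr_ge0 ?exprn_ge0// mulr_ge0// ltW.
  apply: ler_wpM2l => //.
  exact: L2inner_exp_le.
have [M [s [M0 ss0 s1 us]]] := recursion_geometric_bound u0 r0 r1 C0 urec.
(* The bound just obtained is for squared norms. *)
exists (Num.sqrt M), (Num.sqrt s); split; first exact: sqrtr_ge0.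
  by rewrite -(@ltr_pXn2r _ 2)// ?nnegrE ?sqrtr_ge0// sqr_sqrtr// expr1n.
move=> n; rewrite -(@ler_pXn2r _ 2)// ?nnegrE ?rnorm_ge0//.
by rewrite exprMn exprAC !sqr_sqrtr//; exact: us.
Qed.

Lemma Psi_cvg f : L2Linf f -> (Cnorm +oo%E f < (2^-1)%:E)%E ->
  series (fun n => (n`!%:R)^-1 *: B n f) @ \oo --> Psi B f.
Proof.
move=> Lf /L2Linf_ae_le[m [m0 m2 fm]].
have [M [s [s0 s1 h]]] := Fock_norm_le Lf m0 m2 fm.
exact: geometric_cvg_series s0 s1 h.
Qed.

Lemma wdil_quantization_Psi a b (G : {linear H -> H}) : continuous G ->
  (forall n f, L2Linf f -> G (B n f) = B n (wdil a b f)) ->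
  forall f, L2Linf f -> (Cnorm +oo%E f < (2^-1)%:E)%E ->
  G (Psi B f) = Psi B (wdil a b f).
Proof.
move=> cG GB f Lf f2; apply/esym/cvg_lim => //.
have := cvg_comp (series _) G (Psi_cvg Lf f2) (cG _); apply: cvg_trans.
apply: near_eq_cvg; apply: nearW => n /=.
rewrite /series /= linear_sum; apply: eq_bigr => k _.
by rewrite linearZ /= GB.
Qed.

Lemma Cnormy_Z_lt (t : R) f : 0 < t -> t <= 1 ->
  (Cnorm +oo%E f < (2^-1)%:E)%E ->
  (Cnorm +oo%E (fun s => t%:C * f s)%R < (2^-1)%:E)%E.
Proof.
move=> t0 t1 /L2Linf_ae_le[m [m0 m2 fm]].
apply: (@le_lt_trans _ _ m%:E); last by rewrite lte_fin.
apply/Cnormy_le; apply: aeS fm => x fx.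
rewrite Normc.normcM normc_real ?(ltW t0)// (le_trans _ fx)// ler_piMl//.
exact: normc_ge0.
Qed.

Lemma wdilZ a b (z : R[i]) f :
  wdil a b (fun s => z * f s) = (fun s => z * wdil a b f s).
Proof. by apply/funext => s; rewrite /wdil mulrCA. Qed.

Lemma wdil_quantization_Fock a b (G : {linear H -> H}) : b%:num <= 1 ->
  continuous G ->
  (forall f, L2Linf f -> (Cnorm +oo%E f < (2^-1)%:E)%E ->
     G (Psi B f) = Psi B (wdil a b f)) ->
  forall n f, L2Linf f -> G (B n f) = B n (wdil a b f).
Proof.
move=> b1 cG GPsi.
have small n f : L2Linf f -> (Cnorm +oo%E f < (2^-1)%:E)%E ->
    G (B n f) = B n (wdil a b f).
  (* For t f with 0 < t <= 1, homogeneity turns both sides of the hypothesis into power series in t;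
     the [v n] are the differences of their coefficients. *)
  move=> Lf f2; pose v n := (n`!%:R)^-1 *: (G (B n f) - B n (wdil a b f)).
  suff /(_ n)/eqP : forall k, v k = 0.
    by rewrite scaler_eq0 invr_eq0 pnatr_eq0 eqn0Ngt fact_gt0 /= subr_eq0 => /eqP.
  apply: power_series_eq0 => t t0 t1.
  have Lt := L2LinfZ t%:C Lf; have ft := Cnormy_Z_lt t0 t1 f2.
  have LSt := L2Linf_wdil a b Lt.
  have St : (Cnorm +oo%E (wdil a b (fun s => t%:C * f s)%R) < (2^-1)%:E)%E.
    by apply: le_lt_trans ft; exact: wdil_contractiony.
  have c1 := cvg_comp (series _) G (Psi_cvg Lt ft) (cG _).
  have h := cvgB c1 (Psi_cvg LSt St); move: h; rewrite GPsi// subrr => h.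
  suff -> : series (fun k => (t ^+ k)%:C *: v k) = (fun N =>
    G (series (fun k => (k`!%:R)^-1 *: B k (fun s => t%:C * f s)) N) -
    series (fun k => (k`!%:R)^-1 *: B k (wdil a b (fun s => t%:C * f s))) N).
    exact: h.
  apply/funext => N.
  rewrite /series /= linear_sum -sumrB; apply: eq_bigr => k _.
  rewrite /v linearZ /= wdilZ !(FockZ fockH t%:C)//; last exact: L2Linf_wdil.
  by rewrite !linearZ /= rmorphXn scalerA mulrC -scalerA !(scalerBr, scalerN).
move=> n f Lf; have [_ _ [m [m0 fm]]] := (L2LinfP f).1 Lf.
(* This gives t m < 1/2, so the previous case applies to t f, and homogeneity lets t^n be
   cancelled. *)
pose t : R := (2 * (m + 1) + 1)^-1.
have t0 : 0 < t by rewrite invr_gt0; lra.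
have tf : (Cnorm +oo%E (fun s => t%:C * f s)%R < (2^-1)%:E)%E.
  apply: (@le_lt_trans _ _ (t * m)%:E).
    apply/Cnormy_le; apply: aeS fm => x fx.
    by rewrite Normc.normcM normc_real ?(ltW t0)// ler_pM2l.
  rewrite lte_fin /t mulrC ltr_pdivrMr; lra.
have := small n _ (L2LinfZ t%:C Lf) tf.
rewrite wdilZ !(FockZ fockH t%:C)//; last exact: L2Linf_wdil.
rewrite linearZ /=; apply: scalerI; rewrite expf_neq0// gt_eqF// ltcR//.
Qed.

End Quantization.

(** * A two-particle vector that separates the two operators *)

Section NonAdjoint.
Context {R : realType}.
Local Notation mu := (@lebesgue_measure R).
Local Notation TR := (measurableTypeR R).
Local Notation normc := Normc.normc.

(** An idempotent test function: <e^2, (T e)^2> is simply the length of [0, 1/2], in particular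
    nonzero. *)
Definition unit_indicator : R -> R[i] := fun x => (\1_(`[0, 1]%classic : set R) x)%:C.
Local Notation e := unit_indicator.

Lemma normc_unit_indicator x : normc (e x) = \1_(`[0, 1]%classic : set R) x.
Proof. by rewrite normc_real// indicE ler0n. Qed.

Lemma L2Linf_unit_indicator : L2Linf e.
Proof.
apply/L2LinfP; split.
- split; last exact: measurable_cst.
  exact: (measurable_indic (_ : measurable (`[0, 1]%classic : set TR))).
- under eq_integral do rewrite normc_unit_indicator indicE -natrX.
  rewrite (eq_integral (fun x => (\1_(`[0, 1]%classic : set TR) x)%:E)); last first.
    by move=> x _; rewrite indicE; case: (_ \in _).
  rewrite integral_indic// setIT.
  rewrite -[X in (X < _)%E]/(lebesgue_measure (`[0, 1]%classic : set TR)).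
  by rewrite lebesgue_measure_itv/= lte_fin ltr01 -EFinB ltry.
- exists 1; split => //; apply: aeW => x.
  by rewrite normc_unit_indicator indicE lern1 leq_b1.
Qed.

Lemma L2inner_sqr_unit_indicator :
  complex.Re (L2inner (fun s => e s ^+ 2) (fun s => dilation e s ^+ 2)) = 2^-1.
Proof.
rewrite /L2inner /Cintegral /=.
rewrite (_ : (fun s => _) = \1_(`[0, 2^-1]%classic : set TR)).
  rewrite /Rintegral integral_indic// setIT.
  rewrite -[X in fine X]/(lebesgue_measure (`[0, 2^-1]%classic : set TR)).
  rewrite lebesgue_measure_itv/= lte_fin.
  by rewrite invr_gt0 ltr0n /= oppr0 addr0.
apply/funext => x; rewrite /dilation /e !indicE !mem_setE.
rewrite !(mulr0, mul0r, subr0, addr0, oppr0) -!natrM !in_itv /=.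
have -> : (0 <= 2 * x) = (0 <= x) by rewrite pmulr_rge0.
have -> : (x <= 2^-1) = (2 * x <= 1) by rewrite -[2^-1]mul1r ler_pdivlMr// mulrC.
case: (leP 0 x) => x0; case: (leP (2 * x) 1) => h; rewrite /= ?muln0//.
by rewrite (_ : x <= 1)//; lra.
Qed.

Context {H : completeNormedModType R[i]} {c : R}.
Context {form : {dot H for Num.conj}} {Phi : H} {B : nat -> (R -> R[i]) -> H}.
Hypothesis c_gt0 : 0 < c.
Hypothesis fockH : quadratic_Fock c form Phi B.

Lemma Fock_kernel_dilation_adj :
  Fock_kernel (form := form) (B := B) 2 (dilation_adj e) e <>
  Fock_kernel (form := form) (B := B) 2 e (dilation e).
Proof.
have Le := L2Linf_unit_indicator.
have Ld : L2Linf (dilation e) by rewrite dilationE; exact: L2Linf_wdil.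
have La : L2Linf (dilation_adj e) by rewrite dilation_adjE; exact: L2Linf_wdil.
have s1 : L2inner (fun s => dilation_adj e s ^+ 1) (fun s => e s ^+ 1) =
    L2inner (fun s => e s ^+ 1) (fun s => dilation e s ^+ 1).
  exact: dilation_adjP.
have s2 : L2inner (fun s => dilation_adj e s ^+ 2) (fun s => e s ^+ 2) =
    2^-1 * L2inner (fun s => e s ^+ 2) (fun s => dilation e s ^+ 2).
  have L2 := L2Linf_exp 1 Le.
  (* T is multiplicative, (T e)^2 = T(e^2), so the adjoint relation applies to e^2; squaring T' e
     costs one more factor 1/2. *)
  rewrite -[X in _ * X](dilation_adjP L2 L2).
  rewrite -CintegralZ; last first.
    apply: L2inner_integrable => //.
    by rewrite dilation_adjE; exact: L2Linf_wdil.
  congr Cintegral; apply/funext => x; rewrite /dilation_adj exprMn !rmorphM.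
  by rewrite !fmorphV !rmorph_nat -!mulrA.
pose w n k : R[i] := (Fock_weight (c := c) n k)%:C.
have K1 f g : L2Linf f -> L2Linf g -> Fock_kernel (form := form) (B := B) 1 f g =
    w 1 0 * L2inner (fun s => f s ^+ 1) (fun s => g s ^+ 1).
  move=> Lf Lg; rewrite (Fock_kernelS fockH 0 Lf Lg) big_ord1.
  by rewrite (Fock_kernel0 fockH Lf Lg) mulr1.
have K2 f g : L2Linf f -> L2Linf g -> Fock_kernel (form := form) (B := B) 2 f g =
    w 2 0 * (L2inner (fun s => f s ^+ 1) (fun s => g s ^+ 1) *
      (w 1 0 * L2inner (fun s => f s ^+ 1) (fun s => g s ^+ 1))) +
    w 2 1 * L2inner (fun s => f s ^+ 2) (fun s => g s ^+ 2).
  move=> Lf Lg; rewrite (Fock_kernelS fockH 1 Lf Lg) big_ord_recl big_ord1 /=.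
  by rewrite (Fock_kernel0 fockH Lf Lg) (K1 f g Lf Lg) mulr1.
(* The k = 0 terms depend on the first powers alone and cancel, leaving p / 2 = p for the nonzero
   inner product of squares. *)
rewrite (K2 _ _ La Le) (K2 _ _ Le Ld) s1 s2 => /addrI.
have w0 : w 2 1 != 0.
  rewrite gt_eqF// ltcR /Fock_weight !mulr_gt0// ?invr_gt0 ?ltr0n ?exprn_gt0//.
move=> /(mulfI w0) /(congr1 (@complex.Re R)).
have -> : (2^-1 : R[i]) = (2^-1)%:C by rewrite fmorphV rmorph_nat.
move: L2inner_sqr_unit_indicator.
case: (L2inner _ _) => p q /= ->; rewrite mul0r subr0; lra.
Qed.

End NonAdjoint.

Theorem mainTheorem2 (R : realType) (c : R) (c_gt0 : 0 < c)
    (H : completeNormedModType R[i]) (form : {dot H for Num.conj})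
    (Phi : H) (B : nat -> (R -> R[i]) -> H)
    (fockH : quadratic_Fock c form Phi B) :
  [/\ L2Linf_operator (@dilation R),
      L2Linf_operator (@dilation_adj R) &
      forall f g : R -> R[i], L2Linf f -> L2Linf g ->
        L2inner (dilation_adj f) g = L2inner f (dilation g)] /\
  norm_contraction 2%:E (@dilation R) /\
  norm_contraction +oo%E (@dilation R) /\
  (exists G : {linear H -> H}, quadratic_quantization B dilation G) /\
  (exists Gs : {linear H -> H}, quadratic_quantization B dilation_adj Gs) /\
  (forall G Gs : {linear H -> H},
     quadratic_quantization B dilation G ->
     quadratic_quantization B dilation_adj Gs ->
     [/\ contraction_op G, contraction_op Gs & ~ is_adjoint form G Gs]).
Proof.
have quant (a b : {posnum R}) : b%:num <= 1 -> b%:num ^+ 2 <= a%:num ->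
    exists G : {linear H -> H}, quadratic_quantization B (wdil a b) G.
  move=> b1 ba; have [G [cG GB]] := wdil_quantization_exists c_gt0 fockH b1 ba.
  exists G; split => //; first exact: wdil_operator.
    exact: wdil_contractiony.
  exact: (wdil_quantization_Psi c_gt0 fockH cG GB).
have Fock (a b : {posnum R}) (G : {linear H -> H}) : b%:num <= 1 ->
    quadratic_quantization B (wdil a b) G ->
    continuous G /\ forall n f, L2Linf f -> G (B n f) = B n (wdil a b f).
  move=> b1 [_ _ cG GPsi]; split => //.
  exact: (wdil_quantization_Fock c_gt0 fockH b1 cG GPsi).
(* The conditions b <= 1 and b^2 <= a for (1/2, 1/2) and (2, 1). *)
have h1 : 2^-1 <= 1 :> R by lra.
have h2 : (2^-1 : R) ^+ 2 <= 2^-1 by rewrite expr2; lra.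
have h3 : (1 : R) ^+ 2 <= 2 by rewrite expr1n; lra.
split; first split.
- by rewrite dilationE; exact: wdil_operator.
- by rewrite dilation_adjE; exact: wdil_operator.
- exact: dilation_adjP.
split; first by rewrite dilationE; exact: wdil_contraction2.
split; first by rewrite dilationE; exact: wdil_contractiony.
split; first by rewrite dilationE; exact: quant.
split; first by rewrite dilation_adjE; exact: quant.
move=> G Gs; rewrite dilationE dilation_adjE.
move=> /Fock[//|cG GB] /Fock[//|cGs GsB]; split.
- exact: (wdil_quantization_contraction c_gt0 fockH _ _ cG GB).
- exact: (wdil_quantization_contraction c_gt0 fockH _ _ cGs GsB).
- move=> adj; have Le := @L2Linf_unit_indicator R.
  apply: (Fock_kernel_dilation_adj c_gt0 fockH).
  have := adj (B 2%N unit_indicator) (B 2%N unit_indicator).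
  by rewrite GB// GsB// -dilationE -dilation_adjE.
Qed.
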